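(* Consider the two-piece convex knapsack problem $$P^*=\max_{x\in\mathbb{R}^n}\Big\{\sum_{j\in[n]} p_j(x_j) \ :\ \sum_{j\in[n]} x_j\le\Omega,\ 0\le x\le u\Big\},\qquad p_j(x_j)=(\gamma_j+\beta_j x_j)_+,$$ where $\beta_j\ge0$, $u_j\ge 0$, $\Omega>0$, and the full-item profits $p_j(u_j)$ are positive integers, and let $\bar P$ be a given integer upper bound on $P^*$. Then the dynamic programming algorithm described below (Algorithm 2) outputs the optimal value $P^*$ in $O(n(\bar P+\log n))$ time.
   Context: $[n]=\{1,\dots,n\}$, $(t)_+=\max\{t,0\}$. Algorithm 2: first sort and renumber the items so that $\beta_1\ge\beta_2\ge\cdots\ge\beta_n$ (ties $\beta_i=\beta_j$ with $i<j$ broken so that $u_i\le u_j$); this costs $O(n\log n)$. Compute, by the standard binary-knapsack recursion, the table $\zeta(P,k)$ = minimum of $\sum_{j\in S}u_j$ over subsets $S\subseteq[k]$ with $\sum_{j\in S}p_j(u_j)\ge P$ ($+\infty$ if none), for all profit levels $P\le\bar P$ and $k\le n$. For each $f\in[n]$ let $\hat p_f(t)=p_f(t)$ if $0\le t\le u_f$ and $\hat p_f(t)=-\infty$ otherwise, and let $\hat p_{n+1}(t)=0$ for $t\ge0$, $-\infty$ otherwise. Output $\max_{f\in\{1,\dots,n+1\}}\max_{P}\{P+\hat p_f(\Omega-\zeta(P,f-1))\}$, i.e. item $f$ is the (only) possibly fractionally used item and the fully used items are chosen among items $1,\dots,f-1$. Arithmetic operations are counted at unit cost.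
   Formalization: The formal theorem also assumes γ_j ≤ 0 for all j, i.e. p_j(0) = 0; without it the claim is false: for n = 2, γ = β = u = 1, Ω = 1/2 one has P* = 5/2 while the algorithm outputs 3/2. *)

(* Defs.v *)
From HB Require Import structures.
From mathcomp Require Import all_boot all_order all_algebra.
From mathcomp Require Import boolp classical_sets reals constructive_ereal.

Set Implicit Arguments.
Unset Strict Implicit.
Unset Printing Implicit Defensive.

Import Order.TTheory GRing.Theory Num.Theory.

Local Open Scope ring_scope.
Local Open Scope ereal_scope.
Local Open Scope classical_set_scope.

Section Problem.
Variable R : realType.

(* (gamma + beta t)_+. With gamma <= 0 the kink lies in t >= 0, so that both  *)
(* pieces are present and an unused item earns profit gamma beta 0 = 0.       *)
Definition profit (gamma beta t : R) : R := Num.max (gamma + beta * t)%R 0%R.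

Variables (n : nat) (gamma beta u : 'I_n -> R) (Omega : R).

Definition feasible (x : 'I_n -> R) : Prop :=
  (\sum_(j < n) x j <= Omega)%R /\ forall j, (0 <= x j <= u j)%R.

Definition objective (x : 'I_n -> R) : R :=
  (\sum_(j < n) profit (gamma j) (beta j) (x j))%R.

Definition objective_values : set R :=
  [set v | exists2 x, feasible x & objective x = v].

Definition is_maximum (S : set R) (v : R) : Prop := S v /\ ubound S v.

End Problem.

Section Algorithm.
Variable R : realType.

(* Cost model (unit-cost real RAM): a computation is its result paired with   *)
(* the number of instructions executed. Results of arithmetic, comparisons,   *)
(* conversions, array reads and list-cell allocations are obtained only       *)
(* through [exec], one instruction at a time; the remaining code only passes  *)
(* values around and branches on computed booleans and on constructors. Each  *)
(* entry into a recursive procedure executes a [Call], which also accounts    *)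
(* for that control flow.                                                     *)
(*   [RToN] is applied only to full-item profits, which are integers, so that *)
(* it never rounds. [NSub] truncates at 0. Tables are filled from left to     *)
(* right (one [Cons] per entry) and read by index ([Read]).                   *)
Inductive instr : Type -> Type :=
| Call : instr unit
| RAdd of R & R : instr R
| RMul of R & R : instr R
| RLe of R & R : instr bool
| RLt of R & R : instr bool
| RToN of R : instr nat
| EAdd of \bar R & \bar R : instr (\bar R)
| ESub of \bar R & \bar R : instr (\bar R)
| ELe of \bar R & \bar R : instr bool
| NAdd of nat & nat : instr nat
| NSub of nat & nat : instr nat
| NLe of nat & nat : instr bool
| NToE of nat : instr (\bar R)
| Read of seq (\bar R) & nat : instr (\bar R)
| Cons A of A & seq A : instr (seq A).

Definition eval A (i : instr A) : A :=
  match i in instr A' return A' with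
  | Call => tt
  | RAdd x y => (x + y)%R
  | RMul x y => (x * y)%R
  | RLe x y => (x <= y)%R
  | RLt x y => (x < y)%R
  | RToN x => Num.truncn x
  | EAdd x y => x + y
  | ESub x y => x - y
  | ELe x y => x <= y
  | NAdd a b => (a + b)%N
  | NSub a b => (a - b)%N
  | NLe a b => (a <= b)%N
  | NToE a => (a%:R)%:E
  | Read s i => nth +oo s i
  | Cons A x s => x :: s
  end.

Definition comp (A : Type) : Type := (A * nat)%type.

Definition result A (m : comp A) : A := m.1.

Definition time A (m : comp A) : nat := m.2.

Definition ret A (a : A) : comp A := (a, 0%N).

Definition bind A B (m : comp A) (k : A -> comp B) : comp B :=
  let r := k m.1 in (r.1, (m.2 + r.2)%N).

Definition exec A (i : instr A) : comp A := (eval i, 1%N).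

Local Notation "'do' x <- m ; k" := (bind m (fun x => k))
  (at level 200, x name, m at level 100, k at level 200, right associativity).

Record item := Item { offset : R; slope : R; cap : R }.

(* The order of the preprocessing step: decreasing slope, ties by increasing *)
(* capacity.                                                                 *)
Definition before (a b : item) : comp bool :=
  do ba <- exec (RLt (slope b) (slope a));
  if ba then ret true else
  do ab <- exec (RLt (slope a) (slope b));
  if ab then ret false else exec (RLe (cap a) (cap b)).

(* Bottom-up merge sort: the instruction-counting counterpart of [path.sort]. *)
Fixpoint merge_items (s1 : seq item) : seq item -> comp (seq item) :=
  if s1 is x1 :: s1' then
    let fix merge_s1 s2 :=
      do _ <- exec Call;
      if s2 is x2 :: s2' then
        do b <- before x1 x2;
        if b then do s <- merge_items s1' s2; exec (Cons x1 s)
        else do s <- merge_s1 s2'; exec (Cons x2 s)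
      else ret s1 in
    merge_s1
  else fun s2 => do _ <- exec Call; ret s2.

Fixpoint sort_push (s1 : seq item) (ss : seq (seq item)) :
    comp (seq (seq item)) :=
  do _ <- exec Call;
  match ss with
  | [::] => exec (Cons s1 [::])
  | [::] :: ss' => exec (Cons s1 ss')
  | s2 :: ss' =>
      do s <- merge_items s2 s1;
      do ss'' <- sort_push s ss';
      exec (Cons [::] ss'')
  end.

Fixpoint sort_pop (s1 : seq item) (ss : seq (seq item)) : comp (seq item) :=
  do _ <- exec Call;
  if ss is s2 :: ss' then do s <- merge_items s2 s1; sort_pop s ss'
  else ret s1.

Fixpoint sort_loop (ss : seq (seq item)) (s : seq item) : comp (seq item) :=
  do _ <- exec Call;
  if s is x :: s' then
    do s1 <- exec (Cons x [::]);
    do ss' <- sort_push s1 ss;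
    sort_loop ss' s'
  else sort_pop [::] ss.

Definition sort_items (s : seq item) : comp (seq item) := sort_loop [::] s.

Definition item_profit (it : item) (t : R) : comp R :=
  do y <- exec (RMul (slope it) t);
  do z <- exec (RAdd (offset it) y);
  do b <- exec (RLe 0%R z);
  ret (if b then z else 0%R).

Fixpoint tabulate (entry : nat -> comp (\bar R)) (len P : nat) :
    comp (seq (\bar R)) :=
  do _ <- exec Call;
  if len is len'.+1 then
    do z <- entry P;
    do P' <- exec (NAdd P 1);
    do row <- tabulate entry len' P';
    exec (Cons z row)
  else ret [::].

(* zeta(P, 0) = 0 if P <= 0, and +oo otherwise. *)
Definition zeta_entry0 (P : nat) : comp (\bar R) :=
  do b <- exec (NLe P 0);
  ret (if b then 0 else +oo).

(* zeta(P, k) = min(zeta(P, k-1), zeta((P - p_k(u_k))_+, k-1) + u_k), where   *)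
(* [row] is zeta(., k-1), [w] is p_k(u_k) and [c] is u_k. The positive part   *)
(* is harmless: S ranges over all subsets of total profit at least P, so      *)
(* nonpositive profit levels all have the value of level 0.                   *)
Definition zeta_entry (row : seq (\bar R)) (w : nat) (c : R) (P : nat) :
    comp (\bar R) :=
  do z1 <- exec (Read row P);
  do Q <- exec (NSub P w);
  do z2 <- exec (Read row Q);
  do z3 <- exec (EAdd z2 c%:E);
  do b <- exec (ELe z1 z3);
  ret (if b then z1 else z3).

(* The rows zeta(., k) for k = 0, ..., size items; the row passed as argument *)
(* is the current one, and [len] is the number Pbar + 1 of profit levels.     *)
Fixpoint zeta_rows (len : nat) (items : seq item) (row : seq (\bar R)) :
    comp (seq (seq (\bar R))) :=
  do _ <- exec Call;
  if items is it :: items' then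
    do p <- item_profit it (cap it);
    do w <- exec (RToN p);
    do row' <- tabulate (zeta_entry row w (cap it)) len 0;
    do rows <- zeta_rows len items' row';
    exec (Cons row rows)
  else exec (Cons row [::]).

(* The profit of the fractional item, -oo outside of its domain; [None] is   *)
(* the dummy item n+1.                                                       *)
Definition fractional_profit (f : option item) (t : \bar R) : comp (\bar R) :=
  do b <- exec (ELe 0 t);
  if b then
    if f is Some it then
      do b' <- exec (ELe t (cap it)%:E);
      if b' then do p <- item_profit it (fine t); ret p%:E else ret -oo
    else ret 0
  else ret -oo.

(* max over the profit levels from P on of P + \hat p_f(Omega - zeta(P,f-1)), *)
(* [row] listing zeta(., f-1) from level P on.                                *)
Fixpoint best_level (Omega : R) (f : option item) (row : seq (\bar R))
    (P : nat) (best : \bar R) : comp (\bar R) :=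
  do _ <- exec Call;
  if row is z :: row' then
    do t <- exec (ESub Omega%:E z);
    do q <- fractional_profit f t;
    do p <- exec (NToE P);
    do v <- exec (EAdd p q);
    do b <- exec (ELe best v);
    do P' <- exec (NAdd P 1);
    best_level Omega f row' P' (if b then v else best)
  else ret best.

Fixpoint best_fractional (Omega : R) (items : seq item)
    (rows : seq (seq (\bar R))) (best : \bar R) : comp (\bar R) :=
  do _ <- exec Call;
  match rows, items with
  | row :: rows', it :: items' =>
      do best' <- best_level Omega (Some it) row 0 best;
      best_fractional Omega items' rows' best'
  | row :: _, [::] => best_level Omega None row 0 best
  | [::], _ => ret best
  end.

Definition knapsack_dp (items : seq item) (Omega : R) (Pbar : nat) :
    comp (\bar R) :=
  do sorted_items <- sort_items items;
  do len <- exec (NAdd Pbar 1);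
  do row0 <- tabulate zeta_entry0 len 0;
  do rows <- zeta_rows len sorted_items row0;
  best_fractional Omega sorted_items rows -oo.

Definition items_of (n : nat) (gamma beta u : 'I_n -> R) : seq item :=
  [seq Item (gamma j) (beta j) (u j) | j <- enum 'I_n].

End Algorithm.

(* Main.v *)
Require Import Defs.
From HB Require Import structures.
From mathcomp Require Import all_boot all_order all_algebra.
From mathcomp Require Import boolp classical_sets reals constructive_ereal.
From mathcomp Require Import zify lra.

Set Implicit Arguments.
Unset Strict Implicit.
Unset Printing Implicit Defensive.

Import Order.TTheory GRing.Theory Num.Theory.

Local Open Scope ring_scope.

(* Correctness. Shift resource from an item [k] to a partially used item [f]  *)
(* of larger slope: on the increasing piece of [f] this gains at rate         *)
(* [beta f], while [k] loses at most at rate [beta k], so the total profit    *)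
(* does not drop; stop when [f] is full or [k] is empty. If [f] earns nothing *)
(* it can be emptied instead. Hence every feasible point is dominated by one  *)
(* that uses a set [A] of full items and at most one more item, which comes   *)
(* after all of [A] in the sorted order and is followed by unused items only. *)
(* The recursion replaces [A] by the cheapest [B] with at least the same      *)
(* profit and gives the fractional item the remaining [Omega - zeta]; if that *)
(* exceeds its capacity, then [B] together with this item is a feasible set   *)
(* of full items, which the dummy item accounts for. Conversely every finite  *)
(* value compared by the algorithm is at most the objective of a feasible     *)
(* point, so the output is itself an attained maximum and no compactness      *)
(* argument is needed. Cost. The pending runs of merge sort form a binary     *)
(* counter, and each item takes part in at most [log n] of its merges.        *)

(** The output [v] is pinned from both sides. [best_fractional_achievable] gives a feasible [x] with
    objective at least [v]. [objective_le_level_bound] shows that no feasible point exceeds [v], by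
    the exchange argument [fills_sorted] and the minimality of the table entries ([zeta_row_rcons]).
    Hence [x] is optimal with value [v]. The time is that of the sort, bounded through the potential
    argument of [time_sort_push], plus a constant per table entry; [time_knapsack_dp] adds these
    up. *)

#[local] Arguments bind : simpl never.
#[local] Arguments result : simpl never.
#[local] Arguments time : simpl never.

(** * Results and times of composed computations *)

Section CostMonad.
Variable R : realType.

Lemma result_bind A B (m : Defs.comp A) (k : A -> Defs.comp B) :
  result (bind m k) = result (k (result m)).
Proof. by []. Qed.

Lemma result_exec A (i : instr R A) : result (exec i) = eval i.
Proof. by []. Qed.

Lemma result_ret A (a : A) : result (ret a) = a.
Proof. by []. Qed.

Lemma time_bind A B (m : Defs.comp A) (k : A -> Defs.comp B) :
  time (bind m k) = (time m + time (k (result m)))%N.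
Proof. by []. Qed.

Lemma time_exec A (i : instr R A) : time (exec i) = 1%N.
Proof. by []. Qed.

Lemma time_ret A (a : A) : time (ret a) = 0%N.
Proof. by []. Qed.

Definition resultE := (result_bind, result_exec, result_ret).
Definition timeE := (time_bind, time_exec, time_ret).

End CostMonad.

(** * Merge sort: correctness and amortised cost *)

Section Sorting.
Variable R : realType.
Implicit Types (a b : item R) (s : seq (item R)) (ss : seq (seq (item R))).

Definition precedes : rel (item R) := fun a b => result (before a b).

Lemma precedesE a b : precedes a b =
  (slope b < slope a) || ~~ (slope a < slope b) && (cap a <= cap b).
Proof.
rewrite /precedes /before !resultE /=; case: (slope b < slope a) => //=.
by rewrite !resultE /=; case: (slope a < slope b).
Qed.

Lemma precedes_total : total precedes.
Proof.
move=> a b; rewrite !precedesE.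
by case: (ltgtP (slope a) (slope b)) => _ //=; rewrite ?orbT ?le_total.
Qed.

Lemma precedes_slope a b : precedes a b -> slope b <= slope a.
Proof. by rewrite precedesE => /orP[/ltW|/andP[]]; rewrite -?leNgt. Qed.

Lemma merge_itemsS a s1 b s2 :
  merge_items (a :: s1) (b :: s2) =
  bind (exec (Call R)) (fun _ => bind (before a b) (fun ab =>
    if ab then bind (merge_items s1 (b :: s2)) (fun s => exec (Defs.Cons R a s))
    else bind (merge_items (a :: s1) s2) (fun s => exec (Defs.Cons R b s)))).
Proof. by []. Qed.

Lemma result_merge_items s1 s2 :
  result (merge_items s1 s2) = merge precedes s1 s2.
Proof.
elim: s1 s2 => [|a s1 IH1] // s2; elim: s2 => [|b s2 IH2] //.
rewrite merge_itemsS 2!result_bind -/(precedes a b) [RHS]/=.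
by case: (precedes a b); rewrite result_bind ?IH1 ?IH2.
Qed.

Lemma time_before a b : (time (before a b) <= 3)%N.
Proof.
rewrite /before !timeE !resultE /=; case: (slope b < slope a) => //=.
by rewrite !timeE !resultE /=; case: (slope a < slope b).
Qed.

(** Each output cell costs at most 5: a call, three instructions of [before] and a [Cons]. *)
Lemma time_merge_items s1 s2 :
  (time (merge_items s1 s2) <= 5 * (size s1 + size s2) + 1)%N.
Proof.
elim: s1 s2 => [|a s1 IH1] s2; first by rewrite /= !timeE; lia.
elim: s2 => [|b s2 IH2]; first by rewrite /= !timeE; lia.
have := time_before a b; rewrite merge_itemsS 2!time_bind.
case: (result (before a b)); rewrite !timeE.
  by have := IH1 (b :: s2); rewrite /=; lia.
by move: IH2; rewrite /=; lia.
Qed.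

#[local] Arguments merge_items : simpl never.
#[local] Arguments merge : simpl never.

Lemma result_sort_push s ss :
  result (sort_push s ss) = merge_sort_push precedes s ss.
Proof.
elim: ss s => [|[|a s2] ss IH] s //=.
by rewrite 2!result_bind result_merge_items 2!resultE /= IH.
Qed.

Lemma result_sort_pop s ss :
  result (sort_pop s ss) = merge_sort_pop precedes s ss.
Proof.
by elim: ss s => [|s2 ss IH] s //=; rewrite 2!result_bind result_merge_items IH.
Qed.

Lemma result_sort_items s : result (sort_items s) = sort precedes s.
Proof.
rewrite sortE /sort_items; elim: s [::] => [|a s IH] ss.
  by rewrite /= resultE result_sort_pop.
by rewrite /= !resultE IH result_sort_push.
Qed.

(* The runs form a binary counter whose lowest digit has weight [2 ^ i]; the  *)
(* highest digit is nonzero.                                                  *)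
Fixpoint binary_runs (i : nat) ss : bool :=
  if ss is s :: ss' then
    ((size s == 2 ^ i) || nilp s && ~~ nilp ss')%N && binary_runs i.+1 ss'
  else true.

(* Potential of the amortised analysis: an item in a run of size [2 ^ i] has  *)
(* taken part in [i] merges.                                                  *)
Fixpoint merge_potential (i : nat) ss : nat :=
  if ss is s :: ss' then (i * size s + merge_potential i.+1 ss')%N else 0.

Lemma size_sort_push s ss :
  sumn (shape (merge_sort_push precedes s ss)) = (size s + sumn (shape ss))%N.
Proof.
elim: ss s => [|[|a s2] ss IH] s //=.
by rewrite IH size_merge size_cat /=; lia.
Qed.

(** Pushing is a binary increment: two runs of size [2 ^ i] merge into a carry of size [2 ^ i.+1].
    The nonemptiness keeps the leading digit nonzero when the carry leaves an empty digit behind. *)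
Lemma sort_push_runs i s ss : size s = (2 ^ i)%N -> binary_runs i ss ->
  binary_runs i (merge_sort_push precedes s ss) &&
  ~~ nilp (merge_sort_push precedes s ss).
Proof.
elim: ss i s => [|[|a s2] ss IH] i s sz /=; rewrite ?sz ?eqxx //.
  by case/andP=> _ ->.
rewrite orbF => /andP[/eqP sz2 hss].
have szm : size (merge precedes (a :: s2) s) = (2 ^ i.+1)%N.
  by rewrite size_merge size_cat /= sz2 sz expnS; lia.
by have /andP[-> ->] := IH _ _ szm hss; rewrite orbT.
Qed.

(** The term [i * 2 ^ i] is the potential of the pushed run. A carry costs at most [10 * 2 ^ i + 3]
    and raises the potential by [2 ^ i.+1], so weight 8 pays for it; the final 2 covers the last
    call and [Cons]. *)
Lemma time_sort_push i s ss : size s = (2 ^ i)%N -> binary_runs i ss ->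
  (time (sort_push s ss) + 8 * (merge_potential i ss + i * 2 ^ i) <=
   8 * merge_potential i (merge_sort_push precedes s ss) + 2)%N.
Proof.
elim: ss i s => [|[|a s2] ss IH] i s sz /=; rewrite ?timeE ?sz; try lia.
rewrite result_merge_items orbF => /andP[/eqP sz2 hss].
have szm : size (merge precedes (a :: s2) s) = (2 ^ i.+1)%N.
  by rewrite size_merge size_cat /= sz2 sz expnS; lia.
have := time_merge_items (a :: s2) s; have := IH _ _ szm hss.
have := expn_gt0 2 i; rewrite /= sz2 expnS muln0 add0n.
set t1 := time _; set t2 := time _.
nia.
Qed.

(** The leading run alone has this size; hence the number of pending runs is logarithmic. *)
Lemma binary_runs_size i ss : binary_runs i ss -> ~~ nilp ss ->
  (2 ^ (i + (size ss).-1) <= sumn (shape ss))%N.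
Proof.
elim: ss i => [|s ss IH] i //= /andP[hs hss] _.
case: ss IH hs hss => [|s2 ss] IH hs hss.
  by move: hs; rewrite andbF orbF /= !addn0 => /eqP ->.
have := IH _ hss isT; rewrite /= addSnnS => H.
exact: leq_trans H (leq_addl _ _).
Qed.

Lemma merge_potential_le i ss :
  (merge_potential i ss <= (i + (size ss).-1) * sumn (shape ss))%N.
Proof.
elim: ss i => [|s ss IH] i //=.
have := IH i.+1; case: ss {IH} => [|s2 ss] /=; first by nia.
set k := size ss; set x := merge_potential _ _; set y := sumn _.
nia.
Qed.

Lemma time_sort_pop s ss :
  (time (sort_pop s ss) <=
   size ss * (5 * (size s + sumn (shape ss)) + 2) + 1)%N.
Proof.
elim: ss s => [|s2 ss IH] s /=; rewrite !timeE //.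
rewrite result_merge_items.
have := time_merge_items s2 s; have := IH (merge precedes s2 s).
rewrite size_merge size_cat; set t1 := time _; set t2 := time _; nia.
Qed.

(** Each input item costs 4 beyond the potential; [8 * (L * N)] bounds the final potential, and the
    last product bounds at most [L.+1] closing merges. *)
Lemma time_sort_loop ss s (N := (sumn (shape ss) + size s)%N)
    (L := trunc_log 2 N) : binary_runs 0 ss ->
  (time (sort_loop ss s) + 8 * merge_potential 0 ss <=
   4 * size s + 8 * (L * N) + L.+1 * (5 * N + 2) + 2)%N.
Proof.
rewrite {}/L {}/N; elim: s ss => [|a s IH] ss hss.
  rewrite /= !timeE addn0; have := time_sort_pop [::] ss; rewrite add0n.
  have := merge_potential_le 0 ss; rewrite add0n.
  have : ((size ss).-1 <= trunc_log 2 (sumn (shape ss)))%N.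
    have [/nilP -> //|nss] := boolP (nilp ss).
    by apply: trunc_log_max => //; apply: binary_runs_size hss nss.
  set k := size ss; set N := sumn _; set L := trunc_log _ _.
  set t := time _; set W := merge_potential _ _.
  nia.
rewrite /= !timeE /= result_sort_push.
have sz1 : size [:: a] = (2 ^ 0)%N by [].
have /andP[hpush _] := sort_push_runs sz1 hss.
have := IH _ hpush; have := time_sort_push sz1 hss.
rewrite size_sort_push /=.
(* An item only moves from the input to the runs, so [N] and [L] are invariant. *)
have -> : (1 + sumn (shape ss) + size s = sumn (shape ss) + (size s).+1)%N.
  by lia.
set t1 := time _; set t2 := time _; set N := (_ + _)%N; set L := trunc_log _ _.
set X := (L * N)%N; set Y := (L.+1 * _)%N.
lia.
Qed.

Lemma time_sort_items s (n := size s) (L := trunc_log 2 n) :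
  (time (sort_items s) <= 4 * n + 8 * (L * n) + L.+1 * (5 * n + 2) + 2)%N.
Proof. by have := @time_sort_loop [::] s isT; rewrite addn0. Qed.

End Sorting.

(** * Cost of the tables and of the whole algorithm *)

Section DynamicProgramCost.
Variable R : realType.
Implicit Types (it : item R) (s : seq (item R)) (row : seq (\bar R)).

Lemma size_tabulate (entry : nat -> Defs.comp (\bar R)) len P :
  size (result (tabulate entry len P)) = len.
Proof. by elim: len P => //= len IH P; congr _.+1; apply: IH. Qed.

Lemma time_tabulate (entry : nat -> Defs.comp (\bar R)) c len P :
  (forall Q, time (entry Q) <= c)%N ->
  (time (tabulate entry len P) <= len * (c + 3) + 1)%N.
Proof.
move=> hc; elim: len P => [|len IH] P /=; rewrite !timeE ?resultE //=.
by have := hc P; have := IH (P + 1)%N; lia.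
Qed.

Lemma time_item_profit it t : time (item_profit it t) = 3%N.
Proof. by []. Qed.

Lemma time_zeta_rows len s row :
  (time (zeta_rows len s row) <= (size s).+1 * (8 * len + 7))%N.
Proof.
elim: s row => [|it s IH] row /=; first by rewrite !timeE; lia.
rewrite 2!time_bind time_item_profit !timeE.
set row' := result (tabulate _ _ _).
have := IH row'; set c := (cap it); set w := result _.
have := @time_tabulate (zeta_entry row w c) 5 len 0 (fun Q => leqnn 5).
lia.
Qed.

Lemma size_zeta_rows len s row : size row = len ->
  all (fun r => size r == len) (result (zeta_rows len s row)).
Proof.
by elim: s row => [|it s IH] row sz /=; rewrite sz eqxx //= IH ?size_tabulate.
Qed.

Lemma time_fractional_profit f (t : \bar R) :
  (time (fractional_profit f t) <= 5)%N.
Proof.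
rewrite /fractional_profit !timeE !resultE /=; case: ifP => // _.
case: f => [it|] //; rewrite !timeE !resultE /=; case: ifP => // _.
Qed.

Lemma time_best_level Omega f row P best :
  (time (best_level Omega f row P best) <= 11 * size row + 1)%N.
Proof.
elim: row P best => [|z row IH] P best /=.
  by rewrite timeE.
rewrite 2!time_bind.
set q := fractional_profit f _.
have hq : (time q <= 5)%N by exact: time_fractional_profit.
move: q hq => q hq; rewrite !timeE.
set t := time (best_level _ _ _ _ _).
have : (t <= 11 * size row + 1)%N by exact: IH.
lia.
Qed.

Lemma time_best_fractional Omega s rows best len :
  all (fun r => size r == len) rows ->
  (time (best_fractional Omega s rows best) <=
   (size s).+1 * (11 * len + 2))%N.
Proof.
elim: rows s best => [|row rows IH] [|it s] best /=; rewrite !timeE; try lia.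
  by case/andP=> /eqP sz _; have := time_best_level Omega None row 0 best; lia.
case/andP=> /eqP sz /IH {}IH.
have := time_best_level Omega (Some it) row 0 best.
by have := IH s (result (best_level Omega (Some it) row 0 best)); lia.
Qed.

(** Positivity of the product lets it absorb the lower-order terms [n], [Pbar], [L] and the
    constants. *)
Lemma time_knapsack_dp s Omega Pbar (n := size s) (L := trunc_log 2 n) :
  (0 < n * (Pbar + L))%N ->
  (time (knapsack_dp s Omega Pbar) <= 200 * (n * (Pbar + L)))%N.
Proof.
rewrite /knapsack_dp !timeE !resultE result_sort_items /=.
set row0 := result _.
have := @time_best_fractional Omega (sort (@precedes R) s)
  (result (zeta_rows (Pbar + 1) (sort (@precedes R) s) row0))
  -oo%E _ (size_zeta_rows _ (size_tabulate _ _ _)).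
have := time_zeta_rows (Pbar + 1) (sort (@precedes R) s) row0.
have := @time_tabulate (@zeta_entry0 R) 1 (Pbar + 1) 0 (fun Q => leqnn 1).
rewrite size_sort -/n.
set t2 := time _; set t3 := time _; set t4 := time _; set t1 := time _.
move=> h2 h3 h4 pos.
have h1 : (t1 <= 4 * n + 8 * (L * n) + L.+1 * (5 * n + 2) + 2)%N.
  exact: time_sort_items.
have [n0 m0] : (0 < n)%N /\ (0 < Pbar + L)%N.
  by move: pos; rewrite muln_gt0 => /andP.
have : (n <= n * (Pbar + L))%N by exact: leq_pmulr.
have : (Pbar + L <= n * (Pbar + L))%N by exact: leq_pmull.
move: h1 h2 h3 h4; rewrite (mulnDr n) (mulnC L n).
(* Naming the two products makes the remaining inequality linear. *)
set A := (n * L)%N; set B := (n * Pbar)%N.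
have -> : (L.+1 * (5 * n + 2) = 5 * A + 2 * L + 5 * n + 2)%N by rewrite /A; lia.
have -> : (n.+1 * (8 * (Pbar + 1) + 7) =
    8 * B + 15 * n + 8 * Pbar + 15)%N by rewrite /B; lia.
have -> : (n.+1 * (11 * (Pbar + 1) + 2) =
    11 * B + 13 * n + 11 * Pbar + 13)%N by rewrite /B; lia.
lia.
Qed.

End DynamicProgramCost.

(** * The profit function and the exchange inequality *)

Section Profit.
Variable R : realType.
Implicit Types gamma beta s t : R.

Lemma profit_at0 gamma beta : gamma <= 0 -> profit gamma beta 0 = 0.
Proof. by move=> g0; rewrite /profit mulr0 addr0; apply/max_idPr. Qed.

Lemma profit_le gamma beta s t :
  0 <= beta -> s <= t -> profit gamma beta s <= profit gamma beta t.
Proof.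
move=> b0 st; rewrite /profit ge_max !le_max lexx orbT andbT.
by rewrite lerD2l ler_wpM2l.
Qed.

(* On the increasing piece of [f], moving resource from [k] to [f] earns at   *)
(* rate [bf] and loses at most at rate [bk].                                  *)
Lemma profit_exchange gf bf gk bk (t y d : R) :
  0 <= bk <= bf -> 0 <= d -> 0 < profit gf bf t ->
  profit gf bf t + profit gk bk y <=
  profit gf bf (t + d) + profit gk bk (y - d).
Proof.
move=> /andP[bk0 bkf] d0; rewrite /profit lt_max ltxx orbF => pf.
have H : bk * d <= bf * d by rewrite ler_wpM2r.
have H0 : 0 <= bk * d by rewrite mulr_ge0.
rewrite mulrBr mulrDr (max_idPl (ltW pf)) !maxEle.
by case: ifP; case: ifP; case: ifP; lra.
Qed.

End Profit.

(** * The values compared by the algorithm *)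

Section Levels.
Variable R : realType.

Lemma result_item_profit (a : item R) t :
  result (item_profit a t) = profit (offset a) (slope a) t.
Proof.
rewrite /item_profit !resultE /= /profit maxEle.
by case: ifP; case: ifP => // h1 h2; apply/eqP; rewrite eq_le; lra.
Qed.

Lemma nth_tabulate x0 (entry : nat -> Defs.comp (\bar R)) len P i :
  (i < len)%N -> nth x0 (result (tabulate entry len P)) i =
  result (entry (P + i)%N).
Proof.
elim: len P i => // len IH P [|i] /= lti; first by rewrite addn0.
have -> : (P + i.+1 = P + 1 + i)%N by lia.
exact: IH.
Qed.

Definition level_value (Omega : R) f (P : nat) (z : \bar R) : \bar R :=
  ((P%:R)%:E + result (fractional_profit f (Omega%:E - z)))%E.

Lemma best_level_cons Omega f z row P best :
  result (best_level Omega f (z :: row) P best) =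
  result (best_level Omega f row P.+1
    (Order.max best (level_value Omega f P z))).
Proof. by rewrite -addn1 maxEle. Qed.

(** The running maximum is always one of the values compared. *)
Lemma best_level_ind (Q : \bar R -> Prop) Omega f row P best :
  Q best ->
  (forall i, (i < size row)%N ->
     Q (level_value Omega f (P + i) (nth +oo%E row i))) ->
  Q (result (best_level Omega f row P best)).
Proof.
elim: row P best => // z row IH P best Qb Qrow; rewrite best_level_cons.
apply: IH => [|i lti]; last by rewrite addSnnS; apply: (Qrow i.+1).
by rewrite maxEle; case: ifP => // _; have := Qrow 0%N isT; rewrite addn0.
Qed.

Lemma best_level_ge Omega f row P best :
  (best <= result (best_level Omega f row P best))%E /\
  forall i, (i < size row)%N ->
    (level_value Omega f (P + i) (nth +oo%E row i) <=
     result (best_level Omega f row P best))%E.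
Proof.
elim: row P best => [|z row IH] P best; first by [].
rewrite best_level_cons; set b := Order.max _ _.
have [IH0 IHi] := IH P.+1 b; split=> [|[_|i /IHi]].
- by apply: le_trans IH0; rewrite le_max lexx.
- by rewrite addn0; apply: le_trans IH0; rewrite le_max lexx orbT.
- by rewrite addSnnS.
Qed.

Lemma level_value_dummy Omega P (c : R) : c <= Omega ->
  level_value Omega None P c%:E = (P%:R)%:E.
Proof.
move=> cO; rewrite /level_value /fractional_profit !resultE /= -EFinB lee_fin.
by rewrite subr_ge0 cO /= addr0.
Qed.

Lemma level_value_fractional Omega (a : item R) P (c : R) :
  0 <= Omega - c <= cap a ->
  level_value Omega (Some a) P c%:E =
  (P%:R + profit (offset a) (slope a) (Omega - c))%:E.
Proof.
case/andP=> h0 h1; rewrite /level_value /fractional_profit !resultE /= -EFinB.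
rewrite !lee_fin h0 /= !resultE /= lee_fin h1.
by rewrite result_bind result_item_profit.
Qed.

End Levels.

(** * Exchange argument, table rows and optimality of the output *)

Section Knapsack.
Variables (R : realType) (n : nat) (gamma beta u : 'I_n -> R) (Omega : R).
Hypothesis gamma_le0 : forall j, gamma j <= 0.
Hypothesis beta_ge0 : forall j, 0 <= beta j.
Hypothesis u_ge0 : forall j, 0 <= u j.
Hypothesis Omega_ge0 : 0 <= Omega.
Implicit Types (j k f : 'I_n) (l : seq 'I_n) (A : {set 'I_n}) (x : 'I_n -> R).

Local Notation p j := (profit (gamma j) (beta j)).
Local Notation pay j := (p j (u j)).
Local Notation w j := (Num.truncn (pay j)).
Local Notation it j := (Item (gamma j) (beta j) (u j)).
Local Notation obj := (objective gamma beta).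
Local Notation feas := (feasible u Omega).

Hypothesis pay_nat : forall j, pay j = (w j)%:R.

Lemma sum_pay A : \sum_(j in A) pay j = (\sum_(j in A) w j)%:R.
Proof. by rewrite natr_sum; apply: eq_bigr => j _; rewrite -pay_nat. Qed.

Definition fill A j : R := if j \in A then u j else 0.

Definition fill_with A f (t : R) j : R := if j == f then t else fill A j.

(** A generic [F] serves both the resource (identity) and the profit. *)
Lemma sum_fill (F : 'I_n -> R -> R) A : (forall j, F j 0 = 0) ->
  \sum_j F j (fill A j) = \sum_(j in A) F j (u j).
Proof.
move=> F0; rewrite [RHS]big_mkcond; apply: eq_bigr => j _.
by rewrite /fill; case: ifP.
Qed.

Lemma sum_fill_with (F : 'I_n -> R -> R) A f t :
  (forall j, F j 0 = 0) -> f \notin A ->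
  \sum_j F j (fill_with A f t j) = \sum_(j in A) F j (u j) + F f t.
Proof.
move=> F0 fA; rewrite -(sum_fill A F0) (bigD1 f) //= [in RHS](bigD1 f) //=.
have -> : fill A f = 0 by rewrite /fill (negbTE fA).
rewrite {1}/fill_with eqxx F0 add0r addrC; congr (_ + _).
by apply: eq_bigr => j /negbTE jf; rewrite /fill_with jf.
Qed.

Lemma feasible_fill A : \sum_(j in A) u j <= Omega -> feas (fill A).
Proof.
move=> h; split; first by rewrite (sum_fill (F := fun _ => id)).
by move=> j; rewrite /fill; case: ifP => _; rewrite lexx u_ge0.
Qed.

Lemma objective_fill A : obj (fill A) = \sum_(j in A) pay j.
Proof.
by apply: (sum_fill (F := fun j => p j)) => j; apply: profit_at0.
Qed.

Lemma feasible_fill_with A f t : f \notin A -> 0 <= t <= u f ->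
  \sum_(j in A) u j + t <= Omega -> feas (fill_with A f t).
Proof.
move=> fA ht h; split; first by rewrite (sum_fill_with (F := fun _ => id)).
move=> j; rewrite /fill_with; case: eqP => [->|_] //.
by rewrite /fill; case: ifP => _; rewrite lexx u_ge0.
Qed.

Lemma objective_fill_with A f t : f \notin A ->
  obj (fill_with A f t) = \sum_(j in A) pay j + p f t.
Proof.
by apply: (sum_fill_with (F := fun j => p j)) => j; apply: profit_at0.
Qed.

Definition fills_fully l (c v : R) : Prop :=
  exists A, [/\ {subset A <= l}, \sum_(j in A) u j <= c &
    v <= \sum_(j in A) pay j].

(** The split of [l] records that the full items precede [f], as the row read for [f] requires. *)
Definition fills_fractionally l (c v : R) : Prop :=
  exists l1 f l2 A t, l = l1 ++ f :: l2 /\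
    [/\ {subset A <= l1}, 0 <= t <= u f, \sum_(j in A) u j + t <= c &
      v <= \sum_(j in A) pay j + p f t].

(** Appending items by decreasing slope means that the new item [k] is never steeper than the
    partial item [f], so resource may move from [k] to [f]. *)
Lemma fills_sorted l x : uniq l -> pairwise (fun j k => beta k <= beta j) l ->
  (forall j, j \in l -> 0 <= x j <= u j) ->
  fills_fully l (\sum_(j <- l) x j) (\sum_(j <- l) p j (x j)) \/
  fills_fractionally l (\sum_(j <- l) x j) (\sum_(j <- l) p j (x j)).
Proof.
elim/last_ind: l => [|l k IH].
  move=> _ _ _; left; exists finset.set0.
  by split=> [j||]; rewrite ?inE // !big_nil big_set0.
rewrite rcons_uniq pairwise_rcons => /andP[kl ul] /andP[/allP bl pl] hx.
have hxk := hx k; rewrite mem_rcons mem_head in hxk.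
have /andP[xk0 xku] := hxk isT.
rewrite -cats1 !big_cat !big_seq1 /=.
set c := \sum_(j <- l) x j in IH *.
set v := \sum_(j <- l) p j (x j) in IH *.
have add_k A (t c' : R) : {subset A <= l} -> 0 <= t <= u k ->
    \sum_(j in A) u j + t <= c' ->
    v + p k (x k) <= \sum_(j in A) pay j + p k t ->
    fills_fractionally (l ++ [:: k]) c' (v + p k (x k)).
  by move=> *; exists l, k, [::], A, t.
case: IH => // [j jl||].
- by apply: hx; rewrite mem_rcons inE jl orbT.
- case=> A [Al Ac vA]; right; apply: (add_k A (x k)); rewrite ?hxk ?lerD2r //.
case=> l1 [f [l2 [A [t [El [Al /andP[t0 tu] Ac vA]]]]]]; right.
have fl : f \in l by rewrite El mem_cat mem_head orbT.
have l1l j : j \in l1 -> j \in l by rewrite El mem_cat => ->.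
(* If [f] earns nothing, it is emptied and [k] becomes the fractional item. *)
have [pf0|pf0] := lerP (p f t) 0.
  apply: (add_k A (x k)); rewrite ?hxk //; first by move=> j /Al /l1l.
    by rewrite lerD2r; lra.
  by rewrite lerD2r; lra.
have bkf : 0 <= beta k <= beta f by rewrite beta_ge0 bl.
(* Either all of [x k] fits into [f] and [k] is emptied, or [f] becomes full, joins [A], and [k]
   keeps the rest. *)
have [xt|xt] := lerP (x k) (u f - t).
  have := profit_exchange (gamma k) (x k) bkf xk0 pf0.
  rewrite subrr profit_at0 // addr0 => hex.
  exists l1, f, (rcons l2 k), A, (t + x k).
  split; first by rewrite -cats1 El -catA.
  split=> //; [apply/andP; split| |]; lra.
have ut0 : 0 <= u f - t by lra.
have := profit_exchange (gamma k) (x k) bkf ut0 pf0.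
rewrite [t + _]addrC subrK => hex.
have fA : f \notin A.
  apply/negP => /Al fl1; move: ul; rewrite El cat_uniq => /and3P[_ /hasPn + _].
  by move/(_ f); rewrite mem_head fl1 => /(_ isT).
apply: (add_k (f |: A) (x k - (u f - t))).
- by move=> j; rewrite !inE => /orP[/eqP -> //|/Al /l1l].
- by apply/andP; split; lra.
- by rewrite big_setU1 //=; lra.
- by rewrite big_setU1 //=; lra.
Qed.

(** Minimality in two halves: the lower bound serves domination, and attainment turns an entry into
    an actual set. *)
Definition zeta_row len l (row : seq (\bar R)) : Prop :=
  size row = len /\ forall P, (P < len)%N ->
    (forall A, {subset A <= l} -> (P <= \sum_(j in A) w j)%N ->
      (nth +oo row P <= (\sum_(j in A) u j)%:E)%E) /\
    (nth +oo%E row P = +oo%E \/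
     exists A, [/\ {subset A <= l}, (P <= \sum_(j in A) w j)%N &
       nth +oo%E row P = (\sum_(j in A) u j)%:E]).

Lemma zeta_row_nil len :
  zeta_row len [::] (result (tabulate (@zeta_entry0 R) len 0)).
Proof.
split=> [|P Plen]; first exact: size_tabulate.
rewrite nth_tabulate // add0n /zeta_entry0 resultE resultE /=.
split=> [A Anil|].
  have -> : A = finset.set0.
    by apply/finset.setP => j; rewrite !inE; apply/negP => /Anil.
  by rewrite !big_set0 leqn0 => /eqP ->.
case: leqP => P0; last by left.
by right; exists finset.set0; split=> [j||]; rewrite ?inE // !big_set0.
Qed.

(** Sets without [k] are governed by entry [P], sets with [k] by entry [P - w k]; truncated
    subtraction is exact here by [leq_subLR]. *)
Lemma zeta_row_rcons len l k row : zeta_row len l row -> k \notin l ->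
  zeta_row len (rcons l k)
    (result (tabulate (zeta_entry row (w k) (u k)) len 0)).
Proof.
move=> [szrow hrow] kl; split=> [|P Plen]; first exact: size_tabulate.
rewrite nth_tabulate // add0n /zeta_entry !resultE /=.
have Qlen : (P - w k < len)%N by apply: leq_ltn_trans Plen; apply: leq_subr.
have [min1 att1] := hrow _ Plen; have [min2 att2] := hrow _ Qlen.
rewrite -minEle; split=> [A Al PA|].
  have [kA|kA] := boolP (k \in A); last first.
    rewrite ge_min min1 // => j jA; have := Al _ jA.
    by rewrite mem_rcons inE => /predU1P[jk|//]; rewrite -jk jA in kA.
  rewrite ge_min (big_setD1 k kA) /= EFinD addeC leeD2r ?orbT //.
  apply: min2 => [j|].
    rewrite !inE => /andP[jk /Al]; rewrite mem_rcons inE.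
    by rewrite (negbTE jk).
  by move: PA; rewrite (big_setD1 k kA) /= leq_subLR.
rewrite minEle; case: ifP => _.
  case: att1 => [->|[A [Al PA ->]]]; [by left|right].
  by exists A; split=> // j /Al; rewrite mem_rcons inE => ->; rewrite orbT.
case: att2 => [->|[A [Al PA ->]]]; [by left|right].
have kA : k \notin A by apply: contra kl => /Al.
exists (k |: A); rewrite !big_setU1 //=; split.
- by move=> j; rewrite !inE mem_rcons inE => /orP[->|/Al ->]; rewrite ?orbT.
- by rewrite -leq_subLR.
- by rewrite -EFinD addrC.
Qed.

Lemma zeta_rows_cons len k l row :
  result (zeta_rows len [seq it j | j <- k :: l] row) =
  row :: result (zeta_rows len [seq it j | j <- l]
    (result (tabulate (zeta_entry row (w k) (u k)) len 0))).
Proof. by rewrite -[pay k](result_item_profit (it k)). Qed.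

Lemma best_fractional_cons row rows k l best :
  result (best_fractional Omega [seq it j | j <- k :: l] (row :: rows) best) =
  result (best_fractional Omega [seq it j | j <- l] rows
    (result (best_level Omega (Some (it k)) row 0 best))).
Proof. by []. Qed.

(** An inequality, since [-oo] is compared too and a level [P] may understate the profit of its
    set. *)
Definition achievable (v : \bar R) : Prop :=
  exists2 x, feas x & (v <= (obj x)%:E)%E.

Lemma achievable_ninfty : achievable -oo%E.
Proof.
exists (fill finset.set0); rewrite ?leNye //.
by apply: feasible_fill; rewrite big_set0.
Qed.

(** The value is [-oo] if the entry is infinite or the remainder is outside the domain; otherwise
    the attaining set plus the remainder in [k] is feasible. *)
Lemma level_value_achievable len l row (o : option 'I_n) P :
  zeta_row len l row -> (P < len)%N ->
  (if o is Some k then k \notin l else true) ->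
  achievable (level_value Omega (omap (fun k => it k) o) P (nth +oo%E row P)).
Proof.
move=> [_ hrow] Plen ol; have [_ [->|[A [Al PA ->]]]] := hrow _ Plen.
  have := achievable_ninfty.
  by rewrite /level_value /fractional_profit !resultE.
have le_pay : P%:R <= \sum_(j in A) pay j by rewrite sum_pay ler_nat.
have [tO|tO] := lerP (\sum_(j in A) u j) Omega; last first.
  have := achievable_ninfty.
  rewrite /level_value /fractional_profit !resultE /= -EFinB lee_fin subr_ge0.
  by rewrite leNgt tO.
case: o ol => [k kl|_] /=; last first.
  exists (fill A); first exact: feasible_fill.
  by rewrite level_value_dummy // objective_fill lee_fin.
have [tu|tu] := lerP (Omega - \sum_(j in A) u j) (u k); last first.
  have := achievable_ninfty.
  rewrite /level_value /fractional_profit !resultE /= -EFinB !lee_fin subr_ge0.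
  by rewrite tO !resultE /= lee_fin leNgt tu.
have kA : k \notin A by apply: contra kl => /Al.
have t0 : 0 <= Omega - \sum_(j in A) u j by rewrite subr_ge0.
exists (fill_with A k (Omega - \sum_(j in A) u j)).
  by apply: feasible_fill_with; rewrite ?t0 // addrC subrK.
rewrite level_value_fractional /= ?t0 // objective_fill_with // lee_fin.
by rewrite lerD2r.
Qed.

Lemma best_fractional_achievable len l1 l2 row best :
  uniq (l1 ++ l2) -> zeta_row len l1 row -> achievable best ->
  achievable (result (best_fractional Omega [seq it j | j <- l2]
    (result (zeta_rows len [seq it j | j <- l2] row)) best)).
Proof.
elim: l2 l1 row best => [|k l2 IH] l1 row best ul hrow hbest.
  apply: (best_level_ind (f := None)) => // P; rewrite hrow.1 => Plen.
  exact: (level_value_achievable (o := None) hrow).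
rewrite zeta_rows_cons best_fractional_cons.
have kl1 : k \notin l1.
  move: ul; rewrite cat_uniq => /and3P[_ /hasPn/(_ k) + _].
  by apply; rewrite mem_head.
apply: (IH (rcons l1 k)); first by rewrite cat_rcons.
  exact: zeta_row_rcons.
apply: best_level_ind => // P; rewrite hrow.1 => Plen.
exact: (level_value_achievable (o := Some k) hrow).
Qed.

(** Here [l1] holds the processed items, described by [row]. The bound on [best] carries values from
    earlier rows through the induction. *)
Lemma best_fractional_ge len l1 l2 row best
    (v := result (best_fractional Omega [seq it j | j <- l2]
      (result (zeta_rows len [seq it j | j <- l2] row)) best)) :
  uniq (l1 ++ l2) -> zeta_row len l1 row ->
  [/\ (best <= v)%E,
      exists2 row', zeta_row len (l1 ++ l2) row' & forall P, (P < len)%N ->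
        (level_value Omega None P (nth +oo%E row' P) <= v)%E &
      forall la f lb, l2 = la ++ f :: lb ->
        exists2 row', zeta_row len (l1 ++ la) row' & forall P, (P < len)%N ->
        (level_value Omega (Some (it f)) P (nth +oo%E row' P) <= v)%E].
Proof.
rewrite {}/v; elim: l2 l1 row best => [|k l2 IH] l1 row best ul hrow.
  have [ge0 gei] := best_level_ge Omega None row 0 best.
  split=> [//||[|? ?] ? ? //]; exists row; rewrite ?cats0 // => P Plen.
  by apply: gei; rewrite hrow.1.
rewrite zeta_rows_cons best_fractional_cons.
have kl1 : k \notin l1.
  move: ul; rewrite cat_uniq => /and3P[_ /hasPn/(_ k) + _].
  by apply; rewrite mem_head.
rewrite -cat_rcons in ul *.
set b := result (best_level _ _ _ _ _).
have [ge0 gei] := best_level_ge Omega (Some (it k)) row 0 best.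
have [geb dummy fract] := IH _ _ b ul (zeta_row_rcons hrow kl1).
split=> // [|[|k' la] f lb /= []]; first exact: le_trans geb.
  move=> <- _; exists row; rewrite ?cats0 // => P Plen.
  by apply: le_trans geb; apply: gei; rewrite hrow.1.
by move=> <- /fract; rewrite cat_rcons.
Qed.

Lemma objective_le_level_bound l (Pbar : nat) v :
  uniq l -> (forall j, j \in l) ->
  pairwise (fun j k => beta k <= beta j) l ->
  ubound (objective_values gamma beta u Omega) Pbar%:R ->
  (exists2 row, zeta_row Pbar.+1 l row & forall P, (P <= Pbar)%N ->
    (level_value Omega None P (nth +oo%E row P) <= v)%E) ->
  (forall la f lb, l = la ++ f :: lb ->
    exists2 row, zeta_row Pbar.+1 la row & forall P, (P <= Pbar)%N ->
    (level_value Omega (Some (it f)) P (nth +oo%E row P) <= v)%E) ->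
  forall x, feas x -> ((obj x)%:E <= v)%E.
Proof.
move=> ul lT pl ub [row [szrow hrow] dummy] fract x [xO xu].
(* The upper bound on the optimum guarantees that every level needed lies inside the table. *)
have le_Pbar A : \sum_(j in A) u j <= Omega -> (\sum_(j in A) w j <= Pbar)%N.
  move=> AO; rewrite -(ler_nat R) -sum_pay -objective_fill; apply: ub.
  by exists (fill A) => //; apply: feasible_fill.
have fully A : \sum_(j in A) u j <= Omega -> ((\sum_(j in A) pay j)%:E <= v)%E.
  move=> AO; have PA := le_Pbar A AO; have [min1 att] := hrow _ PA.
  rewrite sum_pay; apply: le_trans (dummy _ PA).
  have := min1 A (fun j _ => lT j) (leqnn _).
  case: att => [->|[B [_ _ ->]]] //; rewrite lee_fin => BA.
  by rewrite level_value_dummy // (le_trans BA).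
have suml F : \sum_j F j = \sum_(j <- l) F j :> R.
  apply/perm_big/uniq_perm => //; first exact: index_enum_uniq.
  by move=> j; rewrite mem_index_enum lT.
rewrite /objective suml; rewrite suml in xO.
have [] := fills_sorted ul pl (fun j _ => xu j).
  case=> A [_ Ax vA]; apply: le_trans (fully A (le_trans Ax xO)).
  by rewrite lee_fin.
case=> la [f [lb [A [t [El [Al /andP[t0 tu] Ax vA]]]]]].
have [rowf [szrowf hrowf] fractf] := fract _ _ _ El.
have AO : \sum_(j in A) u j <= Omega by lra.
have PA := le_Pbar A AO; have [min1 att] := hrowf _ PA.
have := min1 A Al (leqnn _); have := fractf _ PA.
(* [A] itself bounds the entry, so it is finite, attained by a [B] that is no costlier than [A] and
   at least as profitable. *)
case: att => [->|[B [Bl AB ->]]] //; rewrite lee_fin => fractB BA.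
have payB : \sum_(j in A) pay j <= \sum_(j in B) pay j.
  by rewrite !sum_pay ler_nat.
have tB : t <= Omega - \sum_(j in B) u j by lra.
have [Bu|Bu] := lerP (Omega - \sum_(j in B) u j) (u f).
  apply: le_trans fractB; rewrite level_value_fractional /=; last first.
    by rewrite Bu andbT; lra.
  rewrite lee_fin (le_trans vA) // -sum_pay lerD2l.
  by apply: profit_le.
(* The remainder exceeds the capacity of [f], so [B] with [f] full fits within [Omega] and the dummy
   item covers it. *)
have fB : f \notin B.
  apply/negP => /Bl fla; move: ul; rewrite El cat_uniq.
  by move=> /and3P[_ /hasPn/(_ f) + _]; rewrite mem_head fla => /(_ isT).
apply: le_trans (fully (f |: B) _); rewrite ?lee_fin big_setU1 //=; last by lra.
have := profit_le (gamma f) (beta_ge0 f) tu; lra.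
Qed.

End Knapsack.

Theorem theorem3 (R : realType) :
  exists C : nat,
  forall (n : nat) (gamma beta u : 'I_n -> R) (Omega : R) (Pbar : nat),
    (forall j, gamma j <= 0) ->
    (forall j, 0 <= beta j) ->
    (forall j, 0 <= u j) ->
    0 < Omega ->
    (forall j, exists2 m : nat,
       (0 < m)%N & profit (gamma j) (beta j) (u j) = m%:R) ->
    ubound (objective_values gamma beta u Omega) Pbar%:R ->
    let run := knapsack_dp (items_of gamma beta u) Omega Pbar in
    (exists2 Pstar : R,
       is_maximum (objective_values gamma beta u Omega) Pstar &
       result run = Pstar%:E) /\
    ((0 < n * (Pbar + trunc_log 2 n))%N ->
     (time run <= C * (n * (Pbar + trunc_log 2 n)))%N).
Proof.
exists 200%N => n gamma beta u Omega Pbar g0 b0 u0 O0 payN ub run.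
split; last first.
  have szn : size (items_of gamma beta u) = n by rewrite size_map size_enum_ord.
  have := @time_knapsack_dp R (items_of gamma beta u) Omega Pbar.
  by rewrite szn.
have pay_nat j : profit (gamma j) (beta j) (u j) =
    (Num.truncn (profit (gamma j) (beta j) (u j)))%:R.
  by have [m _ ->] := payN j; rewrite natrK.
pose it j := Item (gamma j) (beta j) (u j).
(* Indices are sorted instead of items, which may coincide; [sort_map] transfers the result. *)
pose l := sort (relpre it (@precedes R)) (enum 'I_n).
have ul : uniq l by rewrite sort_uniq enum_uniq.
have lT j : j \in l by rewrite mem_sort mem_enum.
have pl : pairwise (fun j k => beta k <= beta j) l.
  rewrite -sorted_pairwise; last by move=> ? ? ? /[swap]; apply: le_trans.
  apply: (@sub_sorted _ (relpre it (@precedes R))).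
    by move=> j k /precedes_slope.
  by apply: sort_sorted => j k; apply: precedes_total.
have hrow0 := @zeta_row_nil R n gamma beta u Pbar.+1.
have runE : result run = result (best_fractional Omega [seq it j | j <- l]
    (result (zeta_rows Pbar.+1 [seq it j | j <- l]
      (result (tabulate (@zeta_entry0 R) Pbar.+1 0)))) -oo%E).
  by rewrite -sort_map -result_sort_items -addn1.
have Omega_ge0 := ltW O0.
have [x xfeas] := best_fractional_achievable g0 u0 Omega_ge0 pay_nat
  (l1 := [::]) ul hrow0 (achievable_ninfty gamma beta u0 Omega_ge0).
have [_ dummy fract] := best_fractional_ge Omega -oo%E
  (l1 := [::]) ul hrow0.
have dom := objective_le_level_bound g0 b0 u0 pay_nat ul lT pl ub dummy fract.
rewrite -/it -runE in dom * => le_x.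
(* The output is at most the objective of [x] and at least that of every feasible point, so [x]
   attains the maximum. *)
exists (objective gamma beta x).
  split; first by exists x.
  move=> _ [y yfeas <-]; rewrite -lee_fin.
  exact: le_trans (dom _ yfeas) le_x.
by apply/eqP; rewrite eq_le le_x dom.
Qed.
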